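(* Let $(a_n)_{n\ge 1}$ be the Ulam sequence. There exists a real number $c>0$ such that for all integers $n \geq 2$, $$ \min_{1 \leq k \leq n} \frac{a_{k+1}}{a_k} \leq 1 + c\, \frac{\log n}{n}.$$
   Context: The Ulam sequence $(a_n)_{n \geq 1}$ is the strictly increasing sequence of positive integers defined by $a_1 = 1$, $a_2 = 2$ and, for $n \geq 2$, $a_{n+1}$ is the smallest integer greater than $a_n$ that can be written in exactly one way as a sum $a_i + a_j$ with $1 \leq i < j \leq n$ (i.e. as a sum of two distinct earlier terms, uniquely). It begins $1,2,3,4,6,8,11,13,\dots$. The sequence is known to be infinite (well-defined for all $n$). Here $\log$ denotes the natural logarithm. *)

(* Defs.v *)
From mathcomp Require Import all_boot.
From mathcomp Require Import boolp.

Set Implicit Arguments.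
Unset Strict Implicit.
Unset Printing Implicit Defensive.

(* Sequences are indexed from 1: the value [a 0] is never used. *)
Definition unique_sum (a : nat -> nat) (n m : nat) : Prop :=
  exists! p : nat * nat,
    [/\ 1 <= p.1, p.1 < p.2, p.2 <= n & a p.1 + a p.2 = m].

Definition next_ulam (a : nat -> nat) (n m : nat) : Prop :=
  [/\ a n < m, unique_sum a n m &
      forall m', a n < m' -> unique_sum a n m' -> m <= m'].

Definition is_ulam (a : nat -> nat) : Prop :=
  [/\ a 1 = 1, a 2 = 2 & forall n, 2 <= n -> next_ulam a n (a n.+1)].

(* [is_ulam] determines exactly one sequence on the positive indices: this is
   the content of [is_ulam_unique] and [is_ulam_exists] below. *)

Lemma unique_sum_eq (a b : nat -> nat) n m :
  (forall k, 1 <= k <= n -> a k = b k) -> unique_sum a n m -> unique_sum b n m.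
Proof.
move=> ab [[i j] [/= [i1 ij jn aij] U]]; exists (i, j).
have E k l : 1 <= k -> k < l -> l <= n -> a k + a l = b k + b l.
  move=> k1 kl ln; rewrite !ab // ?k1 ?ln ?andbT /=.
    exact: leq_trans (ltnW kl).
  exact: leq_trans (ltnW kl) ln.
split=> [|[k l] /= [k1 kl ln bkl]]; first by split=> //=; rewrite -E.
by apply: U; split=> //=; rewrite E.
Qed.

Lemma next_ulam_eq (a b : nat -> nat) n m : 1 <= n ->
  (forall k, 1 <= k <= n -> a k = b k) -> next_ulam a n m -> next_ulam b n m.
Proof.
move=> n1 ab [am um mn].
have abn : a n = b n by rewrite ab // n1 /=.
split; [by rewrite -abn | exact: unique_sum_eq um |].
move=> m'; rewrite -abn => am' um'; apply: mn => //.
by apply: unique_sum_eq um' => k /ab.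
Qed.

Lemma is_ulam_unique (a b : nat -> nat) :
  is_ulam a -> is_ulam b -> forall n, 1 <= n -> a n = b n.
Proof.
move=> [a1 a2 aS] [b1 b2 bS]; elim/ltn_ind=> -[//|[|[|n]]] IH _.
- by rewrite a1.
- by rewrite a2.
have ab k : 1 <= k <= n.+2 -> a k = b k by case/andP=> k1 kn; apply: IH.
have [am um mn] := next_ulam_eq (isT : 1 <= n.+2) ab (aS n.+2 isT).
have [bm vm nn] := bS n.+2 isT.
by apply/eqP; rewrite eqn_leq mn // nn.
Qed.

Lemma next_ulam_exists (a : nat -> nat) n : 2 <= n -> 1 <= a 1 ->
  (forall i j, 1 <= i -> i < j -> j <= n -> a i < a j) ->
  exists m, next_ulam a n m.
Proof.
case: n => [//|[//|n]] _ a1 inc.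
have a0 i : 1 <= i -> i <= n.+2 -> 0 < a i.
  case: i => [//|[//|i]] _ ilen.
  exact: leq_trans (inc 1 i.+2 isT isT ilen).
pose P m := `[< a n.+2 < m /\ unique_sum a n.+2 m >].
have exP : exists m, P m.
  exists (a n.+1 + a n.+2); apply/asboolP; split.
    by rewrite -[X in X < _]add0n ltn_add2r a0.
  exists (n.+1, n.+2); split=> [|[i j] /= [i1 ij jn]]; first by split.
  have : j = n.+2 \/ j < n.+2 by move: jn; rewrite leq_eqVlt => /orP[/eqP|]; auto.
  case=> [ej|jlt] E; last first.
    have := inc _ _ (leq_trans i1 (ltnW ij)) jlt (leqnn _).
    have ilt : i < n.+1 by exact: leq_trans ij _.
    have := inc _ _ i1 ilt (leqnSn _).
    by move=> h1 h2; have := leq_add h1 (ltnW h2); rewrite addSn E ltnn.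
  move: E ij; rewrite ej => /eqP; rewrite eqn_add2r => /eqP E ij.
  have : i = n.+1 \/ i < n.+1 by move: ij; rewrite ltnS leq_eqVlt => /orP[/eqP|]; auto.
  case=> [->//|ilt].
  by have := inc _ _ i1 ilt (leqnSn _); rewrite E ltnn.
case: (ex_minnP exP) => m /asboolP[am um] mn; exists m; split=> // m' am' um'.
by apply: mn; apply/asboolP.
Qed.

Lemma is_ulam_exists : exists a : nat -> nat, is_ulam a.
Proof.
have [nx nxP] : exists nx : (nat -> nat) -> nat -> nat, forall a n,
    (exists m, next_ulam a n m) -> next_ulam a n (nx a n).
  exists (fun a n => if pselect (exists m, next_ulam a n m) is left h
                     then projT1 (cid h) else 0).
  by move=> a n h; case: pselect => // h'; case: cid.
pose fix f n : nat -> nat := if n is k.+1 then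
    (fun i => if i == k.+3 then nx (f k) k.+2 else f k i) else id.
have fS n : f n.+1 = fun i => if i == n.+3 then nx (f n) n.+2 else f n i by [].
have fE n i d : i <= n.+2 -> f (n + d) i = f n i.
  move=> hi; elim: d => [|d IH]; first by rewrite addn0.
  rewrite addnS fS ltn_eqF // ltnS (leq_trans hi) // !ltnS.
  exact: leq_addr.
have f1 n : f n 1 = 1 by rewrite -[n]add0n fE.
have finc n i j : 1 <= i -> i < j -> j <= n.+2 -> f n i < f n j.
  elim: n i j => [//|n IH] i j i1 ij jn.
  have [e _ _] : next_ulam (f n) n.+2 (nx (f n) n.+2).
    by apply: nxP; apply: next_ulam_exists => //; rewrite f1.
  rewrite !fS (ltn_eqF (leq_trans ij jn)).
  case: eqP => [ej|/eqP nej]; last first.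
    by apply: IH => //; rewrite -ltnS ltn_neqAle nej.
  move: ij; rewrite ej ltnS leq_eqVlt => /orP[/eqP->//|ilt].
  exact: ltn_trans (IH _ _ i1 ilt (leqnn _)) e.
exists (fun k => f k k); split; [by []| by [] |].
case=> [//|[//|n]] _.
have H : next_ulam (f n) n.+2 (nx (f n) n.+2).
  by apply: nxP; apply: next_ulam_exists => //; [rewrite f1 | exact: finc].
have -> : f n.+3 n.+3 = nx (f n) n.+2.
  have -> : n.+3 = n.+1 + 2 by rewrite addn2.
  by rewrite fE ?addn2 // fS eqxx.
apply: next_ulam_eq H => // k /andP[_ kn].
have [kn'|nk] := leqP k n.
  by rewrite -[n in LHS](subnKC kn') fE // !leqW.
by rewrite -[k in f k k](subnKC (ltnW nk)) fE // (subnKC (ltnW nk)).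
Qed.

(* Main.v *)
Require Import Defs.
From mathcomp Require Import all_boot all_order all_algebra.
From mathcomp Require Import reals exp.
From mathcomp Require Import boolp sequences zify ring lra.
Import Order.TTheory GRing.Theory Num.Theory.
Local Open Scope ring_scope.

(** Call a pair of indices [(i, j)] with [i < j] far if [L <= j - i], and near
    otherwise. Suppose that [a k.+1 / a k > 1 + d] for all [k] from [1] to [n],
    where [d * (1 + d) ^+ L >= 1]. If [(j, m)] is far, then [a j <= d * a m], so
    [a m + a j] lies strictly between [a m] and [a m.+1]
    ([far_sum_lt]). As [a m.+1] is the least integer above [a m] with exactly
    one representation, [a m + a j] has a second representation [a i + a l]
    with [i < l < m]. Here [a i > a m - a l > d * a l], which forces [(i, l)] to
    be near ([far_sum_is_near_sum]). A far sum also determines its pair: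
    [a m] is the largest term below it ([far_sum_inj]). Hence there are at
    least as many near pairs as far pairs. But with [7 * L] indices there are
    at least [9 * L ^ 2] far pairs and fewer than [7 * L ^ 2] near ones, a
    contradiction ([small_ratio]).

    For [L := n %/ 7] and [d <= 1], the condition [d * (1 + d) ^+ L >= 1] holds
    as soon as [d] is a large enough multiple of [ln n / n], since
    [(1 + d) ^+ L] is then at least [n] ([growth_condition]). When [d >= 1] the
    ratio [a 2 / a 1 = 2] is already small enough. *)

(** * Monotonicity and non-unique sums *)

Section Ulam.
Context {a : nat -> nat} (a_ulam : is_ulam a).

Lemma ulam_ltS k : (1 <= k)%N -> (a k < a k.+1)%N.
Proof.
case: a_ulam => a1 a2 aS; case: k => [//|[_|k _]]; first by rewrite a1 a2.
by have [] := aS k.+2 isT.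
Qed.

Lemma ulam_le i j : (1 <= i)%N -> (i <= j)%N -> (a i <= a j)%N.
Proof.
move=> i1 /subnKC <-; elim: (j - i)%N => [|d IH]; first by rewrite addn0.
by rewrite addnS (leq_trans IH) // ltnW // ulam_ltS //; lia.
Qed.

Lemma ulam_gt0 i : (1 <= i)%N -> (0 < a i)%N.
Proof. by move=> i1; have := @ulam_le 1 i isT i1; case: a_ulam => ->. Qed.

Lemma ulam_lt i j : (1 <= i)%N -> (i < j)%N -> (a i < a j)%N.
Proof.
by move=> i1 ij; apply: leq_trans (ulam_le _ _ _ ij); first exact: ulam_ltS.
Qed.

Lemma ulam_inj i j : (1 <= i)%N -> (1 <= j)%N -> a i = a j -> i = j.
Proof.
move=> i1 j1 e; case: (ltngtP i j) => // ij.
  by have := ulam_lt _ _ i1 ij; rewrite e ltnn.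
by have := ulam_lt _ _ j1 ij; rewrite e ltnn.
Qed.

(** A sum falling strictly between [a m] and [a m.+1] was rejected when
    [a m.+1] was chosen, so it is not uniquely represented. *)
Lemma second_representation j m : (1 <= j)%N -> (j < m)%N ->
  (a j + a m < a m.+1)%N ->
  exists i l, [/\ (1 <= i)%N, (i < l)%N, (l < m)%N & (a i + a l = a j + a m)%N].
Proof.
move=> j1 jm lt; have [_ _ aS] := a_ulam.
have [_ _ least] := aS m (leq_ltn_trans j1 jm).
have aj0 := ulam_gt0 j j1.
apply: contrapT => none.
suff u : unique_sum a m (a j + a m).
  by have := least (a j + a m)%N ltac:(lia) u; rewrite leqNgt lt.
exists (j, m); split=> [|[i l] /= [i1 il lm e]]; first by split.
have [lm'|ml] := ltnP l m; first by case: none; exists i, l.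
have lE : l = m by apply/eqP; rewrite eqn_leq lm.
rewrite lE in e *; congr pair; apply: ulam_inj => //.
by apply/eqP; rewrite -(eqn_add2r (a m)) e.
Qed.

(** * Far and near pairs in a sequence with large ratios *)

Section LargeRatios.
Context {R : realType} {n L : nat} {d : R}.
Hypothesis d_gt0 : 0 < d.
Hypothesis d_growth : 1 <= d * (1 + d) ^+ L.
Hypothesis ratio_gt :
  forall k, (1 <= k <= n)%N -> (1 + d) * (a k)%:R < (a k.+1)%:R.

Lemma ulam_geometric i e : (1 <= i)%N -> (i + e <= n.+1)%N ->
  (a i)%:R * (1 + d) ^+ e <= (a (i + e))%:R.
Proof.
move=> i1; elim: e => [|e IH] le; first by rewrite expr0 mulr1 addn0.
rewrite addnS exprSr mulrA [_ * (1 + d)]mulrC.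
apply: le_trans (ltW (ratio_gt (i + e)%N ltac:(lia))).
by rewrite ler_wpM2l ?IH //; [rewrite addr_ge0 // ltW | lia].
Qed.

Lemma far_le i j : (1 <= i)%N -> (i + L <= j)%N -> (j <= n)%N ->
  (a i)%:R <= d * (a j)%:R.
Proof.
move=> i1 ij jn.
have : (a i)%:R * (1 + d) ^+ L <= (a j)%:R.
  apply: le_trans (ulam_geometric i L i1 ltac:(lia)) _.
  by rewrite ler_nat ulam_le //; lia.
rewrite -(ler_pM2l d_gt0) => h; apply: le_trans h.
by rewrite mulrCA ler_peMr // ler0n.
Qed.

Lemma far_sum_lt j m : (1 <= j)%N -> (j + L <= m)%N -> (m <= n)%N ->
  (a j + a m < a m.+1)%N.
Proof.
move=> j1 jm mn; rewrite -(ltr_nat R) natrD.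
have := far_le j m j1 jm mn.
have := ratio_gt m ltac:(lia).
lra.
Qed.

Lemma far_sum_inj j m j' m' :
  (1 <= j)%N -> (j + L <= m)%N -> (m <= n)%N ->
  (1 <= j')%N -> (j' + L <= m')%N -> (m' <= n)%N ->
  (a j + a m = a j' + a m')%N -> j = j' /\ m = m'.
Proof.
move=> j1 jm mn j1' jm' mn' e.
have lt := far_sum_lt j m j1 jm mn; have lt' := far_sum_lt j' m' j1' jm' mn'.
have mm : m = m'.
  case: (ltngtP m m') => // h.
    by have := ulam_le m.+1 m' isT h; lia.
  by have := ulam_le m'.+1 m isT h; lia.
by split=> //; apply: ulam_inj => //; rewrite mm in e; lia.
Qed.

Lemma far_sum_is_near_sum j m :
  (1 <= j)%N -> (j < m)%N -> (j + L <= m)%N -> (m <= n)%N ->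
  exists i l, [/\ (1 <= i)%N, (i < l < i + L)%N, (l < m)%N
                & (a i + a l = a j + a m)%N].
Proof.
move=> j1 jm jLm mn.
have [i [l [i1 il lm e]]] := second_representation j m j1 jm
  (far_sum_lt j m j1 jLm mn).
exists i, l; split=> //; rewrite il /= ltnNge; apply/negP => far.
have := far_le i l i1 far ltac:(lia).
have := ratio_gt l ltac:(lia).
have : (a l.+1)%:R <= (a m)%:R :> R by rewrite ler_nat ulam_le.
have : (0 : R) < (a j)%:R by rewrite ltr0n ulam_gt0.
have : (a i)%:R + (a l)%:R = (a j)%:R + (a m)%:R :> R by rewrite -!natrD e.
lra.
Qed.

End LargeRatios.

(** * Counting the pairs *)

Lemma small_ratio {R : realType} {n L : nat} {d : R} :
  0 < d -> (0 < L)%N -> (7 * L <= n)%N -> 1 <= d * (1 + d) ^+ L ->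
  exists2 k, (1 <= k <= n)%N & (a k.+1)%:R <= (1 + d) * (a k)%:R.
Proof.
move=> d0 L0 Ln growth; apply: contrapT => none.
have ratio_gt k : (1 <= k <= n)%N -> (1 + d) * (a k)%:R < (a k.+1)%:R.
  by move=> kn; rewrite ltNge; apply/negP => h; apply: none; exists k.
(* The far pairs considered are [(j, j + L + e)] with [1 <= j <= 3 * L] and
   [e < 3 * L]; near pairs are written [(i, i + e)]. *)
pose far := [seq (a j + a (j + L + e))%N |
              j <- iota 1 (3 * L), e <- iota 0 (3 * L)].
pose near := [seq (a i + a (i + e))%N |
               i <- iota 1 (7 * L), e <- iota 1 L.-1].
have uniq_far : uniq far.
  apply: allpairs_uniq; rewrite ?iota_uniq //.
  move=> _ _ /allpairsP[[j e] [/= + + ->]] /allpairsP[[j' e'] [/= + + ->]].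
  rewrite !mem_iota /= => je ee je' ee'.
  by case/(far_sum_inj d0 growth ratio_gt); try lia; move=> -> ?; congr pair; lia.
have sub : {subset far <= near}.
  move=> _ /allpairsP[[j e] [/= + + ->]]; rewrite !mem_iota => je ee.
  have [|||| i [l [i1 il lm E]]] := far_sum_is_near_sum d0 growth ratio_gt
    j (j + L + e)%N; try lia.
  apply/allpairsP; exists (i, l - i)%N => /=; rewrite !mem_iota.
  by split; [lia | lia | rewrite subnKC ?E //; lia].
have := uniq_leq_size uniq_far sub.
by rewrite !size_allpairs !size_iota; nia.
Qed.

End Ulam.

(** * Choice of the constant *)

Lemma expR_half_le {R : realType} (d : R) :
  0 <= d -> d <= 1 -> expR (d / 2) <= 1 + d.
Proof.
move=> d0 d1; have := expR_ge1Dx (- (d / 2)); rewrite expRN => h.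
have e0 := expR_gt0 (d / 2).
have : expR (d / 2) * (1 - d / 2) <= 1.
  by rewrite mulrC -ler_pdivlMr // mul1r.
nra.
Qed.

(** The factor [28] is [2 * 14]: the [2] is lost in [expR (d / 2) <= 1 + d], and
    [14] in [n <= 14 * (n %/ 7)]. *)
Lemma growth_condition {R : realType} (n : nat) (d := 28 * (ln n%:R / n%:R) : R) :
  (7 <= n)%N -> 1 / 2 <= ln n%:R :> R -> d <= 1 ->
  1 <= d * (1 + d) ^+ (n %/ 7).
Proof.
move=> n7 ln_ge d1.
have n0 : (0 : R) < n%:R by rewrite ltr0n; lia.
have dn : d * n%:R = 28 * ln n%:R by rewrite /d; field; rewrite lt0r_neq0.
have d0 : 0 < d by rewrite /d mulr_gt0 // divr_gt0 //; lra.
have nL : n%:R <= 14 * (n %/ 7)%:R :> R by rewrite -natrM ler_nat; lia.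
have pow_ge : n%:R <= (1 + d) ^+ (n %/ 7).
  rewrite -[n%:R in leLHS]lnK ?posrE //.
  apply: (@le_trans _ _ (expR (d / 2) ^+ (n %/ 7))).
    rewrite -expRM_natl ler_expR; clearbody d; nra.
  by rewrite lerXn2r ?nnegrE ?expR_half_le ?expR_ge0 //; lra.
have : d * n%:R <= d * (1 + d) ^+ (n %/ 7) by rewrite ler_pM2l.
lra.
Qed.

Theorem theorem2 (R : realType) (a : nat -> nat) (a_ulam : is_ulam a) :
  exists2 c : R, 0 < c &
    forall n : nat, (2 <= n)%N ->
      \big[Num.min/((a 2%N)%:R / (a 1%N)%:R)]_(1 <= k < n.+1)
         ((a k.+1)%:R / (a k)%:R) <= 1 + c * (ln n%:R / n%:R).
Proof.
exists 28 => [|n n2]; first lra.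
have n0 : (0 : R) < n%:R by rewrite ltr0n; lia.
have ln_ge : 1 / 2 <= ln n%:R :> R.
  have := expR_ge1Dx (- ln n%:R : R); rewrite expRN lnK ?posrE // => h.
  have : n%:R^-1 <= 2^-1 :> R.
    by rewrite lef_pV2 ?posrE // ler_nat.
  lra.
set d := 28 * _.
have d0 : 0 < d by rewrite /d mulr_gt0 // divr_gt0 //; lra.
suff [k kn kd] : exists2 k, (1 <= k <= n)%N & (a k.+1)%:R <= (1 + d) * (a k)%:R.
  apply: (@bigmin_inf_seq _ _ _ _ _ k); rewrite ?mem_index_iota //.
  by rewrite ler_pdivrMr // ltr0n (ulam_gt0 a_ulam) //; case/andP: kn.
have [d1|d1] := leP 1 d.
  by exists 1%N; [lia | case: a_ulam => -> -> _; lra].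
have n14 : (14 < n)%N.
  rewrite -(ltr_nat R).
  have dn : d * n%:R = 28 * ln n%:R by rewrite /d; field; rewrite lt0r_neq0.
  nra.
apply: (small_ratio a_ulam d0 _ _ (growth_condition n _ ln_ge (ltW d1))); lia.
Qed.
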